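(* Let $((A,\cdot_A,\Phi=\{\partial_k\}_{k=1}^m),\mathfrak B,P)$ be a symmetric Rota-Baxter differential Frobenius algebra of weight $\lambda\neq0$, and let $I_{\mathfrak B}:A^*\to A$ be the linear isomorphism induced by $\mathfrak B$, i.e. $\langle I_{\mathfrak B}^{-1}(a),b\rangle=\mathfrak B(a,b)$. Let $r\in A\otimes A$ be the 2-tensor form of $P\circ I_{\mathfrak B}$, defined by $\langle r,x^*\otimes y^*\rangle=\langle(P\circ I_{\mathfrak B})(x^* ),y^*\rangle$ for $x^*,y^*\in A^*$, and let $\hat\Phi$ be the adjoint of $\Phi$ with respect to $\mathfrak B$. Then $r$ is a solution of the $\hat\Phi$-admissible AYBE in $(A,\cdot_A,\Phi)$ and gives rise to a factorizable differential ASI bialgebra $(A,\cdot_A,\Delta_r,\Phi,\hat\Phi)$.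
   Context: All vector spaces are finite-dimensional over a field $\mathbb K$ of characteristic $0$; associative algebras need not be unital or commutative. $L(a)b=a\cdot_A b=R(b)a$; $\tau$ is the flip. Differential algebra $(A,\cdot_A,\Phi=\{\partial_k\}_{k=1}^m)$: an associative algebra with finitely many pairwise commuting derivations. Symmetric Rota-Baxter differential Frobenius algebra of weight $\lambda\in\mathbb K$, $((A,\cdot_A,\Phi),\mathfrak B,P)$: $(A,\cdot_A,\Phi)$ is a differential algebra, $\mathfrak B$ is a nondegenerate symmetric bilinear form with $\mathfrak B(a\cdot_A b,c)=\mathfrak B(a,b\cdot_A c)$, and $P:A\to A$ is linear with $P(a)\cdot_A P(b)=P(P(a)\cdot_A b+a\cdot_A P(b)+\lambda a\cdot_A b)$, $\mathfrak B(a,P(b))+\mathfrak B(P(a),b)+\lambda\mathfrak B(a,b)=0$, and $\partial_kP=P\partial_k$ for all $k$. The adjoint of $\Phi$ with respect to $\mathfrak B$ is $\hat\Phi=\{\hat\partial_k\}_{k=1}^m$ with $\mathfrak B(\partial_k(a),b)=\mathfrak B(a,\hat\partial_k(b))$. For a family $\Psi=\{\eth_k:A\to A\}_{k=1}^m$ of pairwise commuting linear maps, $(A,\cdot_A,\Phi)$ is $\Psi$-admissible if $\eth_k(a)\cdot_A b=a\cdot_A\partial_k(b)+\eth_k(a\cdot_A b)$ and $a\cdot_A\eth_k(b)=\partial_k(a)\cdot_A b+\eth_k(a\cdot_A b)$ for all $a,b,k$. For $r=\sum_i a_i\otimes b_i\in A\otimes A$, $r$ is a solution of the $\Psi$-admissible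 associative Yang-Baxter equation (AYBE) in $(A,\cdot_A,\Phi)$ if $\sum_{i,j}(a_i\cdot_A a_j\otimes b_i\otimes b_j+a_i\otimes a_j\otimes b_i\cdot_A b_j-a_i\otimes a_j\cdot_A b_i\otimes b_j)=0$ and $(\partial_k\otimes\mathrm{id}-\mathrm{id}\otimes\eth_k)(r)=0$, $(\eth_k\otimes\mathrm{id}-\mathrm{id}\otimes\partial_k)(r)=0$ for all $k$. A tensor $s\in A\otimes A$ is $L$-invariant if $(L(a)\otimes\mathrm{id}-\mathrm{id}\otimes R(a))(s)=0$ for all $a$. Put $\Delta_r(a)=(\mathrm{id}\otimes L(a)-R(a)\otimes\mathrm{id})(r)$. ASI bialgebra $(A,\cdot_A,\Delta)$: an associative algebra and coassociative coalgebra with $\Delta(a\cdot_A b)=(R(b)\otimes\mathrm{id})\Delta(a)+(\mathrm{id}\otimes L(a))\Delta(b)$ and $(L(a)\otimes\mathrm{id}-\mathrm{id}\otimes R(a))\Delta(b)=\tau((\mathrm{id}\otimes R(b)-L(b)\otimes\mathrm{id})\Delta(a))$. Differential ASI bialgebra $(A,\cdot_A,\Delta,\Phi,\Psi)$: $(A,\cdot_A,\Delta)$ is an ASI bialgebra, $(A,\cdot_A,\Phi)$ is a $\Psi$-admissible differential algebra, the $\eth_k$ commute and satisfy $\Delta\eth_k=(\eth_k\otimes\mathrm{id}+\mathrm{id}\otimes\eth_k)\Delta$, and $(\partial_k\otimes\mathrm{id})\Delta=(\mathrm{id}\otimes\eth_k)\Delta+\Delta\partial_k$, $(\mathrm{id}\otimes\partial_k)\Delta=(\eth_k\otimes\mathrm{id})\Delta+\Delta\partial_k$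 for all $k$. If $(A,\cdot_A,\Phi)$ is $\Psi$-admissible, $r$ solves the $\Psi$-admissible AYBE and the symmetric part $\frac12(r+\tau(r))$ is $L$-invariant, then $(A,\cdot_A,\Delta_r,\Phi,\Psi)$ is a differential ASI bialgebra (known), called quasi-triangular; it is factorizable if moreover the symmetric part of $r$ is nondegenerate, i.e. $I_r=r_+-r_-:A^*\to A$ is a linear isomorphism, where $\langle r_+(x^* ),y^*\rangle=-\langle x^*,r_-(y^* )\rangle=\langle r,x^*\otimes y^*\rangle$. *)

(* Defs.v *)
From HB Require Import structures.
From mathcomp Require Export all_boot all_algebra.
From mathcomp Require Import ring.

Set Implicit Arguments.
Unset Strict Implicit.
Unset Printing Implicit Defensive.

Import GRing.Theory.
Local Open Scope ring_scope.

Declare Scope tensor_scope.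
Delimit Scope tensor_scope with T.

(* The tensor product of two finite-dimensional spaces is realised as the     *)
(* space of coordinate matrices with respect to the bases vbasis {:U} and     *)
(* vbasis {:V}. The lemmas tliftE and tlift_unique state its universal        *)
(* property; every map out of a tensor product below is given by tlift, that  *)
(* is, by its values on pure tensors.                                         *)
Section Tensor.
Variable K : fieldType.
Implicit Types U V W : vectType K.

Definition tensor U V : vectType K := 'M[K]_(\dim {:U}, \dim {:V}).

Definition tpure U V (a : U) (b : V) : tensor U V :=
  \matrix_(i, j) (coord (vbasis {:U}) i a * coord (vbasis {:V}) j b).

Definition tlift U V W (f : U -> V -> W) : 'Hom(tensor U V, W) :=
  linfun (fun t : tensor U V =>
    \sum_i \sum_j t i j *: f (vbasis {:U})`_i (vbasis {:V})`_j).

End Tensor.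

Notation "a ⊗ b" := (tpure a b)
  (at level 40, left associativity) : tensor_scope.
Local Open Scope tensor_scope.

Section TensorMaps.
Variable K : fieldType.
Implicit Types U V W : vectType K.

Definition tmap U U' V V' (f : 'Hom(U, U')) (g : 'Hom(V, V')) :
  'Hom(tensor U V, tensor U' V') := tlift (fun a b => f a ⊗ g b).

Definition tflip U V : 'Hom(tensor U V, tensor V U) := tlift (fun a b => b ⊗ a).

Definition tassoc U V W : 'Hom(tensor (tensor U V) W, tensor U (tensor V W)) :=
  tlift (fun (t : tensor U V) c => tlift (fun a b => a ⊗ (b ⊗ c)) t).

Definition dual U : vectType K := 'Hom(U, K^o).

Definition tpair U V (t : tensor U V) (x : dual U) (y : dual V) : K :=
  tlift (fun a b => (x a * y b : K^o)) t.

Lemma tlift_is_linear U V W (f : U -> V -> W) : linear (fun t : tensor U V =>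
    \sum_i \sum_j t i j *: f (vbasis {:U})`_i (vbasis {:V})`_j).
Proof.
move=> k s t; rewrite scaler_sumr -big_split; apply: eq_bigr => i _ /=.
rewrite scaler_sumr -big_split; apply: eq_bigr => j _ /=.
by rewrite !mxE scalerDl scalerA.
Qed.

Lemma tliftEsum U V W (f : U -> V -> W) t :
  tlift f t = \sum_i \sum_j t i j *: f (vbasis {:U})`_i (vbasis {:V})`_j.
Proof.
pose h := GRing.isLinear.Build _ _ _ _ _ (tlift_is_linear f).
pose F : {linear tensor U V -> W} := HB.pack (fun t : tensor U V =>
  \sum_i \sum_j t i j *: f (vbasis {:U})`_i (vbasis {:V})`_j) h.
by rewrite /tlift (lfunE F).
Qed.

Lemma tliftE U V W (f : U -> V -> W) (a : U) (b : V) :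
  (forall u, linear (f u)) -> (forall v, linear (f^~ v)) ->
  tlift f (a ⊗ b) = f a b.
Proof.
move=> fr fl.
have sumr u n (c : 'I_n -> K) (e : 'I_n -> V) :
    f u (\sum_j c j *: e j) = \sum_j c j *: f u (e j).
  pose h := GRing.isLinear.Build _ _ _ _ _ (fr u).
  pose F : {linear V -> W} := HB.pack (f u) h.
  by rewrite -[f u]/(F : V -> W) linear_sum; apply: eq_bigr => j _; rewrite linearZ.
have suml v n (c : 'I_n -> K) (e : 'I_n -> U) :
    f (\sum_j c j *: e j) v = \sum_j c j *: f (e j) v.
  pose h := GRing.isLinear.Build _ _ _ _ _ (fl v).
  pose F : {linear U -> W} := HB.pack (f^~ v) h.
  rewrite -[f _ v]/((F : U -> W) _) linear_sum.
  by apply: eq_bigr => j _; rewrite linearZ.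
rewrite tliftEsum {2}(coord_vbasis (memvf a)) suml; apply: eq_bigr => i _.
rewrite {2}(coord_vbasis (memvf b)) sumr scaler_sumr; apply: eq_bigr => j _.
by rewrite scalerA mxE.
Qed.

Lemma tensor_sum_pure U V (t : tensor U V) :
  t = \sum_i \sum_j t i j *: ((vbasis {:U})`_i ⊗ (vbasis {:V})`_j).
Proof.
have freeb W : free (vbasis {:W}) := basis_free (vbasisP {:W}).
apply/matrixP=> k l; rewrite summxE.
have pureE (i : 'I_(\dim {:U})) (j : 'I_(\dim {:V})) :
    ((vbasis {:U})`_i ⊗ (vbasis {:V})`_j) k l
    = (i == k)%:R * (j == l)%:R.
  by rewrite mxE !coord_free.
under eq_bigr do rewrite summxE; rewrite (bigD1 k) //= (bigD1 l) //=.
rewrite mxE pureE !eqxx !mulr1 -addrA -[LHS]addr0; congr (_ + _).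
rewrite big1 ?add0r ?big1 // => [i ik|j jl].
  by rewrite big1 // => j _; rewrite mxE pureE (negPf ik) mul0r mulr0.
by rewrite mxE pureE (negPf jl) !mulr0.
Qed.

Lemma tlift_unique U V W (f g : 'Hom(tensor U V, W)) :
  (forall a b, f (a ⊗ b) = g (a ⊗ b)) -> f = g.
Proof.
move=> fg; apply/lfunP => t; rewrite (tensor_sum_pure t) !linear_sum.
apply: eq_bigr => i _; rewrite !linear_sum; apply: eq_bigr => j _.
by rewrite !linearZ; congr (_ *: _); exact: fg.
Qed.

End TensorMaps.

Section Algebra.
Variables (K : fieldType) (A : vectType K).
Implicit Types (mul : {bilinear A -> A -> A}) (B : {symmetric A}).
Implicit Types (P : 'End(A)) (lambda : K) (r s : tensor A A).

Definition Lmul mul (a : A) : 'End(A) := linfun (mul a).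
Definition Rmul mul (b : A) : 'End(A) := linfun (mul^~ b).

Definition pairwise_commuting m (f : 'I_m -> 'End(A)) :=
  forall k l a, f k (f l a) = f l (f k a).

Record differential_algebra mul m (d : 'I_m -> 'End(A)) : Prop := {
  da_assoc : associative mul;
  da_leibniz : forall k a b, d k (mul a b) = mul (d k a) b + mul a (d k b);
  da_comm : pairwise_commuting d }.

(* Symmetry and bilinearity of B are part of its type. *)
Record sym_RB_diff_Frobenius mul m (d : 'I_m -> 'End(A)) B P lambda : Prop := {
  frob_diff : differential_algebra mul d;
  frob_nondeg : nondegenerate B;
  frob_inv : forall a b c, B (mul a b) c = B a (mul b c);
  frob_RB : forall a b, mul (P a) (P b)
              = P (mul (P a) b + mul a (P b) + lambda *: mul a b);
  frob_compat : forall a b, B a (P b) + B (P a) b + lambda * B a b = 0;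
  frob_comm : forall k a, d k (P a) = P (d k a) }.

Definition is_adjoint B (f g : 'End(A)) := forall a b, B (f a) b = B a (g b).

(* (form_dual B)^-1 is a two-sided inverse when B is nondegenerate: see       *)
(* form_isoK and form_isoVK.                                                  *)
Definition form_dual B : 'Hom(A, dual A) :=
  linfun (fun a => linfun (B a : A -> K^o) : dual A).
Definition form_iso B : 'Hom(dual A, A) := (form_dual B)^-1%VF.

Definition tensor_form (f : 'Hom(dual A, A)) r :=
  forall x y : dual A, tpair r x y = y (f x).

Record admissible mul m (d e : 'I_m -> 'End(A)) : Prop := {
  adm_comm : pairwise_commuting e;
  adm_l : forall k a b, mul (e k a) b = mul a (d k b) + e k (mul a b);
  adm_r : forall k a b, mul a (e k b) = mul (d k a) b + e k (mul a b) }.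

(* With r = \sum_i a_i ⊗ b_i, the pair (a, b) stands for (a_i, b_i) and the   *)
(* pair (a', b') for (a_j, b_j): see AYB_sum.                                 *)
Definition AYB mul r : tensor A (tensor A A) :=
  tlift (fun a b => tlift (fun a' b' =>
    mul a a' ⊗ (b ⊗ b') + a ⊗ (a' ⊗ mul b b') - a ⊗ (mul a' b ⊗ b')) r) r.

Record admissible_AYBE mul m (d e : 'I_m -> 'End(A)) r : Prop := {
  aybe_eq : AYB mul r = 0;
  aybe_d : forall k, (tmap (d k) \1%VF - tmap \1%VF (e k)) r = 0;
  aybe_e : forall k, (tmap (e k) \1%VF - tmap \1%VF (d k)) r = 0 }.

Definition L_invariant mul s :=
  forall a, (tmap (Lmul mul a) \1%VF - tmap \1%VF (Rmul mul a)) s = 0.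

Definition sym_part r : tensor A A := 2%:R^-1 *: (r + tflip A A r).

Definition Delta_of mul r : 'Hom(A, tensor A A) :=
  linfun (fun a => (tmap \1%VF (Lmul mul a) - tmap (Rmul mul a) \1%VF) r).

Record ASI_bialgebra mul (Delta : 'Hom(A, tensor A A)) : Prop := {
  asi_assoc : associative mul;
  asi_coassoc : forall a,
    tassoc A A A (tmap Delta \1%VF (Delta a)) = tmap \1%VF Delta (Delta a);
  asi_mul : forall a b, Delta (mul a b)
    = tmap (Rmul mul b) \1%VF (Delta a) + tmap \1%VF (Lmul mul a) (Delta b);
  asi_sym : forall a b,
    (tmap (Lmul mul a) \1%VF - tmap \1%VF (Rmul mul a)) (Delta b)
    = tflip A A
        ((tmap \1%VF (Rmul mul b) - tmap (Lmul mul b) \1%VF) (Delta a)) }.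

Record diff_ASI_bialgebra mul (Delta : 'Hom(A, tensor A A)) m
    (d e : 'I_m -> 'End(A)) : Prop := {
  dasi_asi : ASI_bialgebra mul Delta;
  dasi_diff : differential_algebra mul d;
  dasi_adm : admissible mul d e;
  dasi_coder : forall k a,
    Delta (e k a) = (tmap (e k) \1%VF + tmap \1%VF (e k)) (Delta a);
  dasi_l : forall k a, tmap (d k) \1%VF (Delta a)
    = tmap \1%VF (e k) (Delta a) + Delta (d k a);
  dasi_r : forall k a, tmap \1%VF (d k) (Delta a)
    = tmap (e k) \1%VF (Delta a) + Delta (d k a) }.

Record quasi_triangular mul m (d e : 'I_m -> 'End(A)) r : Prop := {
  qt_bialg : diff_ASI_bialgebra mul (Delta_of mul r) d e;
  qt_AYBE : admissible_AYBE mul d e r;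
  qt_inv : L_invariant mul (sym_part r) }.

Definition rplus r : 'Hom(dual A, A) :=
  linfun (fun x : dual A => tlift (fun a b => (x a : K) *: b) r).
Definition rminus r : 'Hom(dual A, A) :=
  linfun (fun y : dual A => - tlift (fun a b => (y b : K) *: a) r).
Definition I_of r : 'Hom(dual A, A) := rplus r - rminus r.

Record factorizable mul m (d e : 'I_m -> 'End(A)) r : Prop := {
  fact_qt : quasi_triangular mul d e r;
  fact_iso : bijective (I_of r) }.

End Algebra.

Section Properties.
Variables (K : fieldType) (A : vectType K).
Implicit Types (mul : {bilinear A -> A -> A}) (B : {symmetric A}).
Implicit Types (r : tensor A A).

Lemma linfunE (U V : vectType K) (f : U -> V) : linear f -> linfun f =1 f.
Proof.
move=> lf u; pose h := GRing.isLinear.Build _ _ _ _ _ lf.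
by pose F : {linear U -> V} := HB.pack f h; rewrite (lfunE F).
Qed.

Lemma LmulE mul a b : Lmul mul a b = mul a b.
Proof. by rewrite linfunE // => k x y; rewrite linearPr. Qed.

Lemma RmulE mul a b : Rmul mul b a = mul a b.
Proof. by rewrite linfunE // => k x y; rewrite linearPl. Qed.

Lemma tpure_linearr (U V : vectType K) (a : U) : linear (@tpure K U V a).
Proof.
by move=> k b c; apply/matrixP=> i j; rewrite !mxE linearP mulrDr mulrCA.
Qed.

Lemma tpure_linearl (U V : vectType K) (b : V) :
  linear (fun a : U => a ⊗ b).
Proof.
by move=> k a c; apply/matrixP=> i j; rewrite !mxE linearP mulrDl -mulrA.
Qed.

Lemma tmapE (U U' V V' : vectType K) (f : 'Hom(U, U')) (g : 'Hom(V, V')) a b :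
  tmap f g (a ⊗ b) = f a ⊗ g b.
Proof.
apply: tliftE => [u | v] k x y; rewrite linearP.
  by rewrite tpure_linearr.
by rewrite tpure_linearl.
Qed.

Lemma tflipE (U V : vectType K) (a : U) (b : V) : tflip U V (a ⊗ b) = b ⊗ a.
Proof.
by apply: tliftE => [u | v] k x y; rewrite (tpure_linearr, tpure_linearl).
Qed.

Lemma tpairE (U V : vectType K) (a : U) (b : V) x y :
  tpair (a ⊗ b) x y = x a * y b.
Proof.
rewrite /tpair tliftE // => [u | v] k c d /=; rewrite linearP.
  by rewrite mulrDr mulrCA.
by rewrite mulrDl -mulrA.
Qed.

Lemma tlift_linear (X U V W : vectType K) (F : X -> U -> V -> W) (t : tensor U V) :
  (forall u v, linear (fun a => F a u v)) -> linear (fun a => tlift (F a) t).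
Proof.
move=> lF k a b; rewrite !tliftEsum scaler_sumr -big_split; apply: eq_bigr => i _.
rewrite scaler_sumr -big_split; apply: eq_bigr => j _ /=.
by rewrite lF scalerDr !scalerA mulrC.
Qed.

Lemma tassocE (U V W : vectType K) (a : U) (b : V) (c : W) :
  tassoc U V W ((a ⊗ b) ⊗ c) = a ⊗ (b ⊗ c).
Proof.
rewrite /tassoc tliftE => [|t k x y|v k x y]; last by rewrite linearP.
  by apply: tliftE => [u | v] k x y;
     rewrite (tpure_linearl, tpure_linearr) // tpure_linearr.
rewrite !tliftEsum scaler_sumr -big_split; apply: eq_bigr => i _.
rewrite scaler_sumr -big_split; apply: eq_bigr => j _ /=.
by rewrite !tpure_linearr scalerDr !scalerA mulrC.
Qed.

Lemma AYB_sum mul (n : nat) (a b : 'I_n -> A) :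
  AYB mul (\sum_i a i ⊗ b i) = \sum_i \sum_j
    (mul (a i) (a j) ⊗ (b i ⊗ b j) + a i ⊗ (a j ⊗ mul (b i) (b j))
     - a i ⊗ (mul (a j) (b i) ⊗ b j)).
Proof.
have lin (W : vectType K) (F : A -> A -> W) :
    tlift F (\sum_i a i ⊗ b i) = \sum_i tlift F (a i ⊗ b i).
  by rewrite linear_sum.
rewrite /AYB lin; apply: eq_bigr => i _; rewrite tliftE.
- rewrite lin; apply: eq_bigr => j _ /=.
  by rewrite tliftE // => [u|v] k x y;
    rewrite ?linearPr ?linearPl ?tpure_linearl ?tpure_linearr ?tpure_linearl
      ?tpure_linearr; apply/matrixP=> p q; rewrite !mxE; ring.
- by move=> u; apply: tlift_linear => c d k x y;
    rewrite ?linearPr ?linearPl ?tpure_linearl ?tpure_linearr ?tpure_linearl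
      ?tpure_linearr; apply/matrixP=> p q; rewrite !mxE; ring.
by move=> v; apply: tlift_linear => c d k x y;
  rewrite ?linearPr ?linearPl ?tpure_linearl ?tpure_linearr ?tpure_linearl
    ?tpure_linearr; apply/matrixP=> p q; rewrite !mxE; ring.
Qed.

Lemma Delta_ofE mul r a :
  Delta_of mul r a = (tmap \1%VF (Lmul mul a) - tmap (Rmul mul a) \1%VF) r.
Proof.
rewrite /Delta_of linfunE // => k x y; rewrite !lfunE /= !opp_lfunE.
have l1 : linear (fun a => tmap \1%VF (Lmul mul a) r).
  by apply: (tlift_linear (F := fun a u v => \1%VF u ⊗ Lmul mul a v))
    => u v c p q; rewrite !LmulE linearPl tpure_linearr.
have l2 : linear (fun a => tmap (Rmul mul a) \1%VF r).
  by apply: (tlift_linear (F := fun a u v => Rmul mul a u ⊗ \1%VF v))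
    => u v c p q; rewrite !RmulE linearPr tpure_linearl.
by rewrite l1 l2 scalerBr opprD addrACA.
Qed.

Lemma rplusP r (x y : dual A) : y (rplus r x) = tpair r x y.
Proof.
rewrite /rplus linfunE; last first.
  apply: tlift_linear => u v k x1 x2.
  by rewrite add_lfunE scale_lfunE scalerDl scalerA.
rewrite /tpair !tliftEsum linear_sum; apply: eq_bigr => i _.
rewrite linear_sum; apply: eq_bigr => j _.
by rewrite linearZ; congr (_ *: _); exact: linearZ.
Qed.

Lemma rminusP r (x y : dual A) : - x (rminus r y) = tpair r x y.
Proof.
rewrite /rminus linfunE; last first.
  suff l : linear (fun z : dual A => tlift (fun a b => (z b : K) *: a) r).
    by move=> k z1 z2; rewrite l opprD scalerN.
  apply: tlift_linear => u v k x1 x2.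
  by rewrite add_lfunE scale_lfunE scalerDl scalerA.
rewrite linearN opprK /tpair !tliftEsum linear_sum; apply: eq_bigr => i _.
rewrite linear_sum; apply: eq_bigr => j _.
by rewrite linearZ; congr (_ *: _); rewrite linearZ; apply: mulrC.
Qed.

Lemma form_dualE B a b : form_dual B a b = B a b.
Proof.
have lB u : linear (B u : A -> K^o) by move=> k x y; rewrite linearPr.
rewrite /form_dual linfunE ?linfunE // => k x y; apply/lfunP => z.
by rewrite add_lfunE scale_lfunE !linfunE // linearPl.
Qed.

Lemma form_dual_lker0 B : nondegenerate B -> lker (form_dual B) == 0%VS.
Proof.
move=> /eqP nB; rewrite -subv0 -nB; apply/subvP => a.
rewrite memv_ker => /eqP Ba; apply/mem_orthovP => b _.
by rewrite -form_dualE Ba lfunE.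
Qed.

Lemma form_isoK B : nondegenerate B -> cancel (form_dual B) (form_iso B).
Proof. by move=> nB; apply/lker0_lfunK/form_dual_lker0. Qed.

Lemma form_isoVK B : nondegenerate B -> cancel (form_iso B) (form_dual B).
Proof.
move=> nB x; apply: limg_lfunVK; rewrite (_ : limg _ = fullv) ?memvf //.
apply/eqP; rewrite eqEdim subvf limg_dim_eq ?(eqP (form_dual_lker0 nB)) ?capv0 //.
by rewrite !dimvf /dim /= muln1.
Qed.

Lemma adjoint_exists B (f : 'End(A)) :
  nondegenerate B -> exists! g, is_adjoint B f g.
Proof.
move=> nB; have lf b : linear (fun a => B (f a) b : K^o).
  by move=> k x y; rewrite linearP linearPl.
have ll : linear (fun b => linfun (fun a => B (f a) b : K^o) : dual A).
  by move=> k x y; apply/lfunP=> z; rewrite add_lfunE scale_lfunE !linfunE // linearPr.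
exists (form_iso B \o linfun (fun b => linfun (fun a => B (f a) b : K^o)))%VF.
split=> [a b | g gP].
  rewrite comp_lfunE [RHS]hermC /= expr0 mul1r -[RHS]form_dualE form_isoVK //.
  by rewrite (linfunE ll) linfunE.
apply/lfunP => b; apply: (can_inj (form_isoK nB)); apply/lfunP => a.
rewrite comp_lfunE form_isoVK // (linfunE ll) linfunE // gP.
by rewrite form_dualE [LHS]hermC /= expr0 mul1r.
Qed.

Lemma tensor_form_exists (f : 'Hom(dual A, A)) : exists! r, tensor_form f r.
Proof.
pose e := vbasis {:A}; have eb : basis_of {:A} e := vbasisP _.
have fe := basis_free eb.
pose c i : dual A := linfun (coord e i : A -> K^o).
have cE i a : c i a = coord e i a.
  by rewrite linfunE // => k x y; rewrite linearP.
have pE r (x y : dual A) : tpair r x y = \sum_i \sum_j r i j * (x e`_i * y e`_j).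
  by rewrite /tpair tliftEsum.
have cp r i j : tpair r (c i) (c j) = r i j.
  rewrite pE (bigD1 i) //= (bigD1 j) //= !cE !coord_free // !eqxx !mulr1 -addrA.
  rewrite -[RHS]addr0; congr (_ + _).
  rewrite big1 ?add0r ?big1 // => [p pi|q qj].
    by rewrite big1 // => q _; rewrite !cE !coord_free // (negPf pi) mul0r mulr0.
  by rewrite !cE !coord_free // (negPf qj) !mulr0.
pose r0 : tensor A A := \sum_(i < \dim {:A}) e`_i ⊗ f (c i).
have r0P : tensor_form f r0.
  move=> x y.
  have -> : tpair r0 x y = \sum_(i < \dim {:A}) x e`_i * y (f (c i)).
    rewrite /tpair /r0 linear_sum; apply: eq_bigr => i _; exact: tpairE.
  have xE : x = \sum_(i < \dim {:A}) (x e`_i : K) *: c i.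
    apply/lfunP => a; rewrite sum_lfunE {1}(coord_vbasis (memvf a)) linear_sum.
    apply: eq_bigr => i _; rewrite linearZ scale_lfunE cE; exact: mulrC.
  rewrite [in RHS]xE !linear_sum; apply: eq_bigr => i _.
  by rewrite !linearZ.
exists r0; split=> // r' r'P; apply/matrixP => i j.
by rewrite -[LHS]cp -[RHS]cp r0P r'P.
Qed.

End Properties.

(* Main.v *)
(* Contraction of the first leg against B identifies A ⊗ V with the linear maps
   A -> V, and it turns (f ⊗ g) t into g o t o f^*, where f^* is the adjoint
   of f. Under this identification r becomes P, its flip the adjoint
   P^* = - P - lambda, and Delta_r(a) the commutator [L(a), P]. All axioms
   thereby become identities in A that follow from the Rota-Baxter relation and
   the invariance of B; coassociativity, for instance, is dual to the
   associativity of the product P x y + x P y + lambda x y. Finally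
   I_r = - lambda I_B, which is invertible since lambda is nonzero. *)
Require Import Defs.
From mathcomp Require Import ring.
Set Implicit Arguments.
Unset Strict Implicit.
Unset Printing Implicit Defensive.

Import GRing.Theory.
Local Open Scope ring_scope.
Local Open Scope tensor_scope.

(** * Contraction of the first tensor leg against a symmetric form *)

Section Contraction.
Variables (K : fieldType) (A : vectType K) (B : {symmetric A}).
Implicit Types V W : vectType K.

Definition contract V (x : A) : 'Hom(tensor A V, V) :=
  tlift (fun a v => (B x a : K) *: v).

Lemma contractE V x a (v : V) : contract V x (a ⊗ v) = B x a *: v.
Proof.
apply: tliftE => [u | w] k p q; first by rewrite scalerDr !scalerA mulrC.
by rewrite linearPr scalerDl scalerA.
Qed.

Lemma sym_formC a b : B a b = B b a.
Proof. by rewrite [LHS]hermC /= expr0 mul1r. Qed.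

Lemma is_adjoint_sym f g : is_adjoint B f g -> is_adjoint B g f.
Proof. by move=> fg a b; rewrite sym_formC -fg sym_formC. Qed.

Lemma contract_tmap V W (f f' : 'End(A)) (g : 'Hom(V, W)) x t :
  is_adjoint B f f' ->
  contract W x (tmap f g t) = g (contract V (f' x) t).
Proof.
move=> ff'; rewrite -[LHS]comp_lfunE -[RHS]comp_lfunE; congr (fun_of_lfun _ t).
apply: tlift_unique => a v; rewrite !comp_lfunE tmapE !contractE linearZ.
by rewrite (is_adjoint_sym ff').
Qed.

Lemma contract_tmap1 V W (g : 'Hom(V, W)) x t :
  contract W x (tmap \1%VF g t) = g (contract V x t).
Proof. by rewrite (@contract_tmap _ _ _ \1%VF) ?id_lfunE // => a b; rewrite !id_lfunE. Qed.

(** Contraction touches only the first leg, so it absorbs the associator; this lets identities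
    between threefold tensors be tested by contracting twice. *)
Lemma contract_tassoc V W x (t : tensor A V) (w : W) :
  contract _ x (tassoc A V W (t ⊗ w)) = contract V x t ⊗ w.
Proof.
pose rt (U : vectType K) : 'Hom(U, tensor U W) := linfun (fun u => u ⊗ w).
have rtE (U : vectType K) (u : U) : rt U u = u ⊗ w by apply: linfunE; exact: tpure_linearl.
have /lfunP/(_ t) : (contract _ x \o (tassoc A V W \o rt _) = rt _ \o contract V x)%VF.
  apply: tlift_unique => a v; rewrite !comp_lfunE !rtE tassocE !contractE.
  by rewrite -!rtE linearZ.
by rewrite !comp_lfunE !rtE.
Qed.

Lemma contract_tflip x y t :
  B y (contract A x (tflip A A t)) = B x (contract A y t).
Proof.
rewrite (tensor_sum_pure t) !linear_sum; apply: eq_bigr => i _.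
rewrite !linear_sum; apply: eq_bigr => j _.
rewrite !linearZ /= tflipE !contractE !linearZ /=; ring.
Qed.

Hypothesis nondegB : nondegenerate B.

Lemma nondegenerate_inj a b : (forall c, B c a = B c b) -> a = b.
Proof.
move=> ab; apply: (can_inj (form_isoK nondegB)); apply/lfunP => c.
by rewrite !form_dualE sym_formC ab sym_formC.
Qed.

Lemma contract_inj V (s t : tensor A V) :
  (forall x, contract V x s = contract V x t) -> s = t.
Proof.
move=> st; apply/matrixP => i j.
(* By nondegeneracy the [i]-th coordinate functional is [B] against [form_iso B c], so contracting
   with that vector reads off row [i] of the matrix. *)
pose c : dual A := linfun (coord (vbasis {:A}) i : A -> K^o).
have cE a : B (form_iso B c) a = coord (vbasis {:A}) i a.
  by rewrite -form_dualE form_isoVK // linfunE // => k p q; rewrite linearP.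
have fr W : free (vbasis {:W}) by apply: basis_free (vbasisP {:W}).
have coordE (u : tensor A V) : u i j
    = coord (vbasis {:V}) j (contract V (form_iso B c) u).
  rewrite /contract tliftEsum (bigD1 i) //= [X in _ + X]big1 => [|p pi].
    rewrite addr0 linear_sum (bigD1 j) //= big1 => [|q qj].
      by rewrite cE !linearZ /= !coord_free // !eqxx addr0 !mulr1.
    by rewrite !linearZ /= coord_free // (negPf qj) !mulr0.
  by rewrite big1 // => q _; rewrite cE coord_free // (negPf pi) scale0r scaler0.
by rewrite !coordE st.
Qed.

End Contraction.

(** * Adjoints with respect to the Frobenius form *)

Section RotaBaxterTensor.
Variables (K : fieldType) (A : vectType K) (mul : {bilinear A -> A -> A}).
Variables (m : nat) (d : 'I_m -> 'End(A)) (B : {symmetric A}) (P : 'End(A)).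
Variables (lambda : K) (hA : sym_RB_diff_Frobenius mul d B P lambda).
Variables (r : tensor A A) (hr : tensor_form (P \o form_iso B)%VF r).
Variables (dhat : 'I_m -> 'End(A)).
Hypothesis hdhat : forall k, is_adjoint B (d k) (dhat k).

Let nondegB : nondegenerate B := frob_nondeg hA.
Let mulA : associative mul := da_assoc (frob_diff hA).

Lemma form_cyclic a b c : B (mul a b) c = B b (mul c a).
Proof. by rewrite sym_formC -(frob_inv hA) sym_formC. Qed.

Lemma is_adjoint_Lmul a : is_adjoint B (Lmul mul a) (Rmul mul a).
Proof. by move=> b c; rewrite LmulE RmulE form_cyclic. Qed.

Lemma is_adjoint_Rmul a : is_adjoint B (Rmul mul a) (Lmul mul a).
Proof. exact: is_adjoint_sym (is_adjoint_Lmul a). Qed.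

Lemma dhat_adjoint k : is_adjoint B (dhat k) (d k).
Proof. exact: is_adjoint_sym (hdhat k). Qed.

Lemma form_RB a b : B (P a) b = - B a (P b) - lambda * B a b.
Proof. by apply/eqP; rewrite -subr_eq0 -(frob_compat hA a b); apply/eqP; ring. Qed.

Lemma form_RBr a b : B a (P b) = - B (P a) b - lambda * B a b.
Proof. by rewrite form_RB; ring. Qed.

(** This is the adjoint of the relation between [d k] and [P]: commuting with the adjoint
    [- P - lambda] is the same as commuting with [P]. *)
Lemma dhat_RB k a : dhat k (P a) = P (dhat k a).
Proof.
apply: (nondegenerate_inj nondegB) => c.
by rewrite -hdhat !form_RBr -!hdhat (frob_comm hA).
Qed.

(** * Contractions of [r], its flip and its coproduct *)

Lemma contract_r x : contract B A x r = P x.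
Proof.
apply: (can_inj (form_isoK nondegB)); apply/lfunP => y.
transitivity (tpair r (form_dual B x) (form_dual B y)).
  rewrite form_dualE sym_formC /tpair /contract !tliftEsum linear_sumr.
  apply: eq_bigr => i _; rewrite linear_sumr; apply: eq_bigr => j _.
  by rewrite !linearZr /= !form_dualE.
by rewrite hr comp_lfunE form_isoK // !form_dualE sym_formC.
Qed.

Lemma contract_tmap_r (f f' g : 'End(A)) x :
  is_adjoint B f f' -> contract B A x (tmap f g r) = g (P (f' x)).
Proof. by move=> ff'; rewrite (contract_tmap _ _ _ ff') contract_r. Qed.

Lemma contract_flip_r x : contract B A x (tflip A A r) = - P x - lambda *: x.
Proof.
apply: (nondegenerate_inj nondegB) => y.
rewrite contract_tflip contract_r linearBr linearNr linearZr /=.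
by rewrite sym_formC form_RB.
Qed.

Lemma contract_Delta a x :
  contract B A x (Delta_of mul r a) = mul a (P x) - P (mul a x).
Proof.
rewrite Delta_ofE add_lfunE opp_lfunE linearB /= contract_tmap1 contract_r.
by rewrite (contract_tmap_r _ _ (is_adjoint_Rmul a)) id_lfunE !LmulE.
Qed.

(** * Admissibility and the Yang-Baxter equation *)

Lemma RB_tensor_admissible : admissible mul d dhat.
Proof.
split=> [k l a|k a b|k a b]; apply: (nondegenerate_inj nondegB) => c.
- by rewrite -!hdhat (da_comm (frob_diff hA)).
(* Transposed through the invariance of [B], both remaining identities become the Leibniz rule for
   [d k]. *)
- rewrite linearDr /= -hdhat !(sym_formC B c) !(frob_inv hA) dhat_adjoint.
  rewrite (sym_formC B _ (mul a b)) (frob_inv hA) (da_leibniz (frob_diff hA)).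
  by rewrite linearDr addrC.
- rewrite linearDr /= -hdhat -!(frob_inv hA) -hdhat.
  by rewrite (da_leibniz (frob_diff hA)) linearDl addrC.
Qed.

(** Grouping the coordinate matrix row by row leaves a single summation index, the form that
    [AYB_sum] needs. *)
Lemma tensor_sum_pairs (t : tensor A A) :
  exists n (a b : 'I_n -> A), t = \sum_i a i ⊗ b i.
Proof.
exists _, (fun i => (vbasis {:A})`_i), (fun i => \sum_j t i j *: (vbasis {:A})`_j).
rewrite [LHS]tensor_sum_pure; apply: eq_bigr => i _.
apply/matrixP => p q; rewrite summxE mxE linear_sum mulr_sumr.
by apply: eq_bigr => j _; rewrite !mxE linearZ /=; ring.
Qed.

Lemma RB_tensor_AYB : AYB mul r = 0.
Proof.
apply: (contract_inj nondegB) => x; apply: (contract_inj nondegB) => y.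
rewrite !linear0.
have [n [a [b rE]]] := tensor_sum_pairs r.
have PE z : \sum_i B z (a i) *: b i = P z.
  rewrite -contract_r rE linear_sum; apply: eq_bigr => i _.
  by rewrite /= contractE.
have PtE z : \sum_i B z (b i) *: a i = - P z - lambda *: z.
  rewrite -contract_flip_r rE !linear_sum; apply: eq_bigr => i _.
  by rewrite /= tflipE contractE.
(* [T1], [T2], [T3] are the three Yang-Baxter terms contracted with [x] in the first leg and [y] in
   the second. Where a product is contracted, invariance of [B] splits it, and the sums collapse to
   [P] or to its adjoint. *)
have T1 : \sum_i \sum_j B x (mul (a i) (a j)) *: (B y (b i) *: b j)
    = P (mul x (- P y - lambda *: y)).
  rewrite -PtE -PE exchange_big; apply: eq_bigr => j _ /=.
  rewrite linear_sum linear_sumlz scaler_suml; apply: eq_bigr => i _ /=.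
  by rewrite linearZr linearZl_LR /= (frob_inv hA) scalerA mulrC.
have T2 : \sum_i \sum_j B x (a i) *: (B y (a j) *: mul (b i) (b j))
    = mul (P x) (P y).
  rewrite -!PE linear_sumlz; apply: eq_bigr => i _ /=.
  rewrite linear_sum; apply: eq_bigr => j _ /=.
  by rewrite linearZr linearZl_LR /= !scalerA mulrC.
have T3 : \sum_i \sum_j B x (a i) *: (B y (mul (a j) (b i)) *: b j)
    = P (mul (P x) y).
  rewrite -PE exchange_big; apply: eq_bigr => j _ /=.
  rewrite form_cyclic -PE !linear_sum scaler_suml; apply: eq_bigr => i _ /=.
  by rewrite !linearZr /= scalerA.
transitivity (P (mul x (- P y - lambda *: y)) + mul (P x) (P y) - P (mul (P x) y)).
  rewrite -T1 -T2 -T3 {1}rE AYB_sum -sumrN -!big_split !linear_sum.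
  apply: eq_bigr => i _; rewrite -sumrN -!big_split !linear_sum.
  apply: eq_bigr => j _; rewrite /= !(linearB, linearD) /= !contractE.
  rewrite ?linearZ /= ?contractE.
  by rewrite !scalerN !scalerA; congr (_ *: _ + _ *: _ - _); ring.
(* Expanding [mul (P x) (P y)] by the Rota-Baxter relation cancels the other two terms. *)
rewrite (frob_RB hA) !(linearD, linearN, linearZ) /=.
rewrite scalerN -opprD -[X in _ + X - _]addrA [X in _ + X - _]addrC addKr.
exact: subrr.
Qed.

Lemma RB_tensor_AYBE : admissible_AYBE mul d dhat r.
Proof.
split=> [|k|k]; first exact: RB_tensor_AYB.
  apply: (contract_inj nondegB) => x; rewrite add_lfunE opp_lfunE linearB /=.
  rewrite contract_tmap1 contract_r (contract_tmap_r _ _ (hdhat k)) id_lfunE.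
  by rewrite dhat_RB subrr linear0.
apply: (contract_inj nondegB) => x; rewrite add_lfunE opp_lfunE linearB /=.
rewrite contract_tmap1 contract_r (contract_tmap_r _ _ (dhat_adjoint k)) id_lfunE.
by rewrite (frob_comm hA) subrr linear0.
Qed.

(** * Invariance of the symmetric part *)

Lemma contract_sym_part x :
  contract B A x (sym_part r) = (- (lambda / 2%:R)) *: x.
Proof.
rewrite linearZ linearD /= contract_r contract_flip_r.
by rewrite addrA addrN add0r scalerN scalerA mulrC scaleNr.
Qed.

(** The symmetric part acts as a scalar and [Rmul] is adjoint to [Lmul], so both terms contract to
    the same multiple of [mul x a]. *)
Lemma RB_tensor_sym_part_invariant : L_invariant mul (sym_part r).
Proof.
move=> a; apply: (contract_inj nondegB) => x.
rewrite add_lfunE opp_lfunE linearB /= contract_tmap1.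
rewrite (contract_tmap _ _ _ (is_adjoint_Lmul a)) !contract_sym_part id_lfunE.
by rewrite linearZ subrr linear0.
Qed.

(** * The bialgebra axioms *)

Lemma RB_tensor_coassoc a :
  tassoc A A A (tmap (Delta_of mul r) \1%VF (Delta_of mul r a))
  = tmap \1%VF (Delta_of mul r) (Delta_of mul r a).
Proof.
apply: (contract_inj nondegB) => x; apply: (contract_inj nondegB) => y.
rewrite contract_tmap1 !contract_Delta.
(* The product dual to the coproduct: contracting [Delta_of mul r p] with [x] and then pairing with
   [y] gives [B star p]. *)
pose star := mul (P x) y + mul x (P y) + lambda *: mul x y.
transitivity (contract B A star (Delta_of mul r a)).
  have /lfunP/(_ (Delta_of mul r a)) : (contract B A y \o (contract B _ x \o
      (tassoc A A A \o tmap (Delta_of mul r) \1)) = contract B A star)%VF.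
    apply: tlift_unique => p q; rewrite !comp_lfunE tmapE id_lfunE.
    rewrite contract_tassoc !contractE contract_Delta; congr (_ *: _).
    rewrite linearBr /= form_RBr /star !linearDl linearZl_LR /= !form_cyclic.
    by ring.
  by rewrite !comp_lfunE.
(* The Rota-Baxter relation enters twice: it turns [P star] into [mul (P x) (P y)] and expands
   [mul (P (mul a x)) (P y)]. *)
rewrite contract_Delta -(frob_RB hA) /star !linearBl /= (frob_RB hA (mul a x)).
apply: (nondegenerate_inj nondegB) => c.
rewrite !(linearDr, linearZr_LR, linearD, linearB, linearZ) /= !mulA; ring.
Qed.

Lemma RB_tensor_ASI : ASI_bialgebra mul (Delta_of mul r).
Proof.
split=> [|a|a b|a b].
- exact: mulA.
- exact: RB_tensor_coassoc.
(* This is the derivation rule [L(a)L(b), P] = [L(a), P]L(b) + L(a)[L(b), P]. *)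
- apply: (contract_inj nondegB) => x; rewrite linearD /= contract_tmap1.
  rewrite (contract_tmap _ _ _ (is_adjoint_Rmul b)) !contract_Delta id_lfunE.
  rewrite !LmulE linearBr /= !mulA.
  by rewrite [RHS]addrC addrA subrK.
apply: (contract_inj nondegB) => x; apply: (nondegenerate_inj nondegB) => y.
rewrite contract_tflip !(add_lfunE, opp_lfunE) !linearB /= !contract_tmap1.
rewrite !(contract_tmap _ _ _ (is_adjoint_Lmul _)) !contract_Delta !id_lfunE !RmulE.
(* Each of the four terms on the left is moved onto [x] across [B]; the resulting [lambda] terms
   cancel in pairs. *)
have E1 : B y (mul b (P (mul x a)))
    = - B (mul a (P (mul y b))) x - lambda * B (mul a (mul y b)) x.
  by rewrite -(frob_inv hA) form_RBr -!form_cyclic.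
have E2 : B y (P (mul b (mul x a)))
    = - B (mul (mul a (P y)) b) x - lambda * B (mul (mul a y) b) x.
  by rewrite form_RBr mulA -!(form_cyclic a _ (mul b x)) -!(frob_inv hA).
have E3 : B y (mul (mul b (P x)) a)
    = - B (P (mul a (mul y b))) x - lambda * B (mul a (mul y b)) x.
  by rewrite -form_cyclic -(frob_inv hA) form_RBr mulA.
have E4 : B y (mul (P (mul b x)) a)
    = - B (mul (P (mul a y)) b) x - lambda * B (mul (mul a y) b) x.
  by rewrite -form_cyclic form_RBr -!(frob_inv hA).
rewrite !(linearBl, linearBr) /= {}E1 {}E2 {}E3 {}E4 ![B x _]sym_formC !mulA.
by ring.
Qed.

Lemma RB_tensor_diff_ASI :
  diff_ASI_bialgebra mul (Delta_of mul r) d dhat.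
Proof.
have [_ adml admr] := RB_tensor_admissible.
split=> [|||k a|k a|k a].
- exact: RB_tensor_ASI.
- exact: frob_diff hA.
- exact: RB_tensor_admissible.
(* The three compatibilities come in turn from the left admissibility identity, the right one and
   the Leibniz rule, as [P] commutes with [d k] and [dhat k]. *)
- apply: (contract_inj nondegB) => x; rewrite add_lfunE linearD /=.
  rewrite contract_tmap1 (contract_tmap _ _ _ (dhat_adjoint k)).
  rewrite id_lfunE !contract_Delta !adml linearB linearD /= dhat_RB (frob_comm hA).
  by rewrite opprD addrACA addrA.
- apply: (contract_inj nondegB) => x; rewrite linearD /=.
  rewrite contract_tmap1 (contract_tmap _ _ _ (hdhat k)).
  rewrite id_lfunE !contract_Delta -dhat_RB !admr linearB linearD /= dhat_RB.
  by apply: (nondegenerate_inj nondegB) => c; rewrite !(linearD, linearB) /=; ring.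
apply: (contract_inj nondegB) => x; rewrite linearD /=.
rewrite contract_tmap1 (contract_tmap _ _ _ (dhat_adjoint k)).
rewrite id_lfunE !contract_Delta linearB /= !(da_leibniz (frob_diff hA)).
rewrite !(frob_comm hA) (da_leibniz (frob_diff hA)) linearD /=.
by apply: (nondegenerate_inj nondegB) => c; rewrite !(linearD, linearB) /=; ring.
Qed.

(** * Factorizability *)

Lemma RB_tensor_I_of x : I_of r x = (- lambda) *: form_iso B x.
Proof.
apply: (nondegenerate_inj nondegB) => b; rewrite -[x](form_isoVK nondegB).
move: (form_iso B x) => a; rewrite (form_isoK nondegB) -form_dualE.
(* Here [rplus r] is [P] after [form_iso B], while [rminus r] is minus the adjoint of [P], that is
   [P + lambda], after it; only [lambda] survives in the difference. *)
rewrite add_lfunE opp_lfunE linearB /= rplusP rminusP !hr !comp_lfunE.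
rewrite !(form_isoK nondegB) !form_dualE form_RBr linearZr_LR /=.
by rewrite (sym_formC _ (P b)); ring.
Qed.

Lemma RB_tensor_factorizable : lambda != 0 -> factorizable mul d dhat r.
Proof.
move=> lambda0; split.
  split.
  - exact: RB_tensor_diff_ASI.
  - exact: RB_tensor_AYBE.
  - exact: RB_tensor_sym_part_invariant.
exists (fun a => form_dual B ((- lambda)^-1 *: a)) => x.
  by rewrite RB_tensor_I_of scalerA mulVf ?oppr_eq0 // scale1r form_isoVK.
by rewrite RB_tensor_I_of form_isoK // scalerA mulfV ?oppr_eq0 // scale1r.
Qed.

End RotaBaxterTensor.

Theorem theorem5p19 (K : fieldType) (charK : [pchar K] =i pred0)
    (A : vectType K) (mul : {bilinear A -> A -> A})
    (m : nat) (d : 'I_m -> 'End(A)) (B : {symmetric A}) (P : 'End(A))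
    (lambda : K) (hA : sym_RB_diff_Frobenius mul d B P lambda)
    (lambda_neq0 : lambda != 0)
    (r : tensor A A) (hr : tensor_form (P \o form_iso B)%VF r)
    (dhat : 'I_m -> 'End(A)) (hdhat : forall k, is_adjoint B (d k) (dhat k)) :
  admissible_AYBE mul d dhat r /\ factorizable mul d dhat r.
Proof.
split; first exact: (RB_tensor_AYBE hA hr hdhat).
exact: (RB_tensor_factorizable hA hr hdhat lambda_neq0).
Qed.
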